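(* Let $M$ be an arbitrary first-order structure. The following are equivalent: (1) $G:=\operatorname{Aut}(M)$, with the pointwise convergence topology, is amenable; (2) $M$ has the embedding convex Ramsey property (ECRP); (3) $M$ has the strong ECRP.
   Context: A topological group $G$ is amenable if every continuous action of $G$ on a nonempty compact Hausdorff space admits a $G$-invariant (regular Borel) probability measure. For a tuple $\bar a$ and $B\subseteq M$, ${B\choose\bar a}:=\{\bar a'\subseteq B:\bar a'=f(\bar a)\text{ for some }f\in\operatorname{Aut}(M)\}$. For finite $B\subseteq C\subseteq M$ with $\bar b$ an enumeration of $B$, $\left\langle\begin{smallmatrix}C\\ \bar b\end{smallmatrix}\right\rangle$ is the set of all formal convex combinations $v=\lambda_1\bar b_1+\dots+\lambda_k\bar b_k$ with $k\geq 1$, $\bar b_i\in{C\choose\bar b}$, $\lambda_i\in[0,1]$, $\sum\lambda_i=1$. For a tuple $\bar a$ in $B$ and $\bar a'\in{B\choose\bar a}$, put $v\circ\bar a':=\lambda_1\bar a'_1+\dots+\lambda_k\bar a'_k$ where $\bar a'_i=\sigma_i(\bar a')$ for any $\sigma_i\in\operatorname{Aut}(M)$ with $\sigma_i(\bar b)=\bar b_i$. For a coloring $c\colon{C\choose\bar a}\to 2^r=\{0,1\}^r$, put $c(v\circ\bar a'):=\sum_i\lambda_i c(\bar a'_i)\in[0,1]^r$. $M$ has the ECRP if for every $\epsilon>0$, every finite tuple $\bar a$ in $M$, every enumeration $\bar b$ of a finite set $B\subseteq M$ containing $\bar a$, and every $r\in\omega$, there is a finite $C\subseteq M$ containing $B$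 such that for every coloring $c\colon{C\choose\bar a}\to 2^r$ there is $v\in\left\langle\begin{smallmatrix}C\\ \bar b\end{smallmatrix}\right\rangle$ with $|c(v\circ\bar a')-c(v\circ\bar a'')|_{\sup}\leq\epsilon$ for all $\bar a',\bar a''\in{B\choose\bar a}$, where $|\cdot|_{\sup}$ is the supremum norm on $[0,1]^r$. $M$ has the strong ECRP if the same holds with $\epsilon=0$. *)

(* Defs.v *)
From HB Require Import structures.
From mathcomp Require Import all_boot all_order all_algebra.
From mathcomp Require Import all_classical all_reals all_analysis.

Set Implicit Arguments.
Unset Strict Implicit.
Unset Printing Implicit Defensive.

Import Order.TTheory GRing.Theory Num.Theory.
Import numFieldNormedType.Exports.

Local Open Scope classical_set_scope.
Local Open Scope ring_scope.

(* An n-tuple of elements of an arbitrary type T is a function 'I_n -> T. *)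

Record language := Language {
  fun_symbol : Type;
  fun_arity : fun_symbol -> nat;
  rel_symbol : Type;
  rel_arity : rel_symbol -> nat }.

Record structure (L : language) := Structure {
  carrier :> Type;
  fun_interp : forall s : fun_symbol L,
    ('I_(fun_arity s) -> carrier) -> carrier;
  rel_interp : forall s : rel_symbol L,
    ('I_(rel_arity s) -> carrier) -> Prop }.

Arguments fun_interp {L M} s x : rename.
Arguments rel_interp {L M} s x : rename.

Definition is_automorphism (L : language) (M : structure L) (f : M -> M) :=
  [/\ bijective f,
      forall (s : fun_symbol L) (x : 'I_(fun_arity s) -> M),
        f (fun_interp s x) = fun_interp s (f \o x) &
      forall (s : rel_symbol L) (x : 'I_(rel_arity s) -> M),
        rel_interp s (f \o x) <-> rel_interp s x].

Record Aut (L : language) (M : structure L) := MkAut {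
  aut_fun :> M -> M;
  autP : is_automorphism aut_fun }.

HB.mixin Record Topological_Group_isTopologicalGroup G
    & Topological G & Group G := {
  mulg_continuous : continuous (fun x : G * G => (x.1 * x.2)%g);
  invg_continuous : continuous (fun x : G => (x^-1)%g) }.

#[short(type="topologicalGroupType")]
HB.structure Definition TopologicalGroup :=
  {G of Topological G & Group G & Topological_Group_isTopologicalGroup G}.

Section aut_group.
Context (L : language) (M : structure L).
Implicit Types f g h : Aut M.

Lemma aut_eqP f g : (f : M -> M) =1 g -> f = g.
Proof.
case: f g => [f fP] [g gP] /= /funext fg.
by subst g; congr MkAut; exact: Prop_irrelevance.
Qed.

Lemma aut_one_subproof : is_automorphism (idfun : M -> M).
Proof. by split=> //; exists idfun. Qed.

Lemma aut_mul_subproof f g : is_automorphism (f \o g).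
Proof.
case: f g => [f [bf ff rf]] [g [bg fg rg]]; split=> /=.
- exact: bij_comp.
- by move=> s x; rewrite fg ff.
- by move=> s x; rewrite -[X in rel_interp _ X]/(f \o (g \o x)) rf rg.
Qed.

Lemma aut_inv_ex f : exists g, cancel f g /\ cancel g f.
Proof.
case: f => f [[g fK gK] ff rf].
have gP : is_automorphism g.
  split; first by exists f.
  - move=> s x; rewrite -[in RHS](fK (fun_interp _ _)) ff.
    by congr (g (fun_interp _ _)); apply/funext => i /=; rewrite gK.
  - move=> s x; rewrite -rf.
    by have -> : f \o (g \o x) = x by apply/funext => i /=; rewrite gK.
by exists (MkAut gP).
Qed.

Definition aut_one : Aut M := MkAut aut_one_subproof.
Definition aut_mul f g : Aut M := MkAut (aut_mul_subproof f g).
Definition aut_inv f : Aut M := sval (cid (aut_inv_ex f)).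

Lemma aut_invK f : cancel f (aut_inv f).
Proof. by rewrite /aut_inv; case: cid => g []. Qed.

Lemma aut_Kinv f : cancel (aut_inv f) f.
Proof. by rewrite /aut_inv; case: cid => g []. Qed.

HB.instance Definition _ := gen_eqMixin (Aut M).
HB.instance Definition _ := gen_choiceMixin (Aut M).

Fact aut_mulA : associative aut_mul.
Proof. by move=> f g h; apply: aut_eqP. Qed.
Fact aut_mul1 : left_id aut_one aut_mul.
Proof. by move=> f; apply: aut_eqP. Qed.
Fact aut_mulr1 : right_id aut_one aut_mul.
Proof. by move=> f; apply: aut_eqP. Qed.
Fact aut_mulV : left_inverse aut_one aut_inv aut_mul.
Proof. by move=> f; apply: aut_eqP => x; exact: aut_invK. Qed.
Fact aut_mulrV : right_inverse aut_one aut_inv aut_mul.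
Proof. by move=> f; apply: aut_eqP => x; exact: aut_Kinv. Qed.

HB.instance Definition _ := isGroup.Build (Aut M)
  aut_mulA aut_mul1 aut_mulr1 aut_mulV aut_mulrV.

(* Pointwise convergence topology: the topology induced by M^M, where M is
   discrete. *)
HB.instance Definition _ := Topological.copy (Aut M)
  (initial_topology
    (@aut_fun L M : Aut M -> {ptws M -> discrete_topology {classic M}})).

Lemma near_aut f (x : M) : \forall g \near f, (g : Aut M) x = f x.
Proof.
pose N := {ptws M -> discrete_topology {classic M}}.
have FF : @Filter N ((@aut_fun L M : Aut M -> N) @ f).
  exact: fmap_filter (nbhs_filter f).
have cf := @initial_continuous (Aut M) N (@aut_fun L M) f.
have /(_ x) := (iffLR (@cvg_sup _ _ _ _ _ FF)) cf.
move=> /(_ [set g | g x = f x]); apply.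
have op : open ([set f x] : set (discrete_topology {classic M})).
  exact: discrete_open.
exists ((fun g : M -> M => g x) @^-1` [set f x]); split => //.
by exists [set f x].
Qed.

Lemma aut_continuousP (T : topologicalType) (F : T -> Aut M) :
  (forall t x, \forall u \near t, F u x = F t x) -> continuous F.
Proof.
move=> FP; apply: (@continuous_comp_initial (Aut M) T
  {ptws M -> discrete_topology {classic M}} (@aut_fun L M)) => t.
apply/cvg_sup => x U [_ [[V oV <-] /= Vt VU]].
by apply: filterS (FP t x) => u /= e; apply: VU; rewrite /= e.
Qed.

Fact aut_mul_continuous : continuous (fun p : Aut M * Aut M => (p.1 * p.2)%g).
Proof.
apply: aut_continuousP => -[f g] x.
exists ([set f' : Aut M | f' (g x) = f (g x)], [set g' : Aut M | g' x = g x]).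
  by split; exact: near_aut.
by move=> [f' g'] /= [fE gE]; rewrite -[LHS]/(f' (g' x)) gE fE.
Qed.

Fact aut_inv_continuous : continuous (fun f : Aut M => (f^-1)%g).
Proof.
apply: aut_continuousP => f x.
apply: filterS (near_aut f (aut_inv f x)) => g gE.
rewrite -[LHS]/(aut_inv g x) -[RHS]/(aut_inv f x).
by rewrite -{1}(aut_Kinv f x) -gE aut_invK.
Qed.

HB.instance Definition _ := Topological_Group_isTopologicalGroup.Build (Aut M)
  aut_mul_continuous aut_inv_continuous.

End aut_group.

Section amenability.
Variable R : realType.

Definition continuous_action (G : topologicalGroupType) (X : topologicalType)
    (act : G -> X -> X) :=
  [/\ forall x, act 1%g x = x,
      forall g h x, act (g * h)%g x = act g (act h x) &
      continuous (fun p : G * X => act p.1 p.2)].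

Definition borel (X : ptopologicalType) := g_sigma_algebraType (@open X).

HB.instance Definition _ (X : ptopologicalType) := Measurable.on (borel X).

Definition regular_measure (X : ptopologicalType) (mu : probability (borel X) R) :=
  forall A : set (borel X), measurable A ->
    mu A = ereal_inf [set mu U | U in [set U : set X | open U /\ A `<=` U]] /\
    mu A = ereal_sup [set mu K | K in [set K : set X | compact K /\ K `<=` A]].

Definition invariant_measure (G : topologicalGroupType) (X : ptopologicalType)
    (act : G -> X -> X) (mu : probability (borel X) R) :=
  forall (g : G) (A : set (borel X)), measurable A ->
    mu (act g @^-1` A) = mu A.

(* The point carried by a ptopologicalType expresses that X is nonempty. *)
Definition amenable (G : topologicalGroupType) :=
  forall (X : ptopologicalType) (act : G -> X -> X),
    compact [set: X] -> hausdorff_space X -> continuous_action act ->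
    exists mu : probability (borel X) R, regular_measure mu /\ invariant_measure act mu.

End amenability.

Section convex_ramsey.
Variables (R : realType) (L : language) (M : structure L).

Definition copies n (B : set M) (a : 'I_n -> M) : set ('I_n -> M) :=
  [set a' | range a' `<=` B /\ exists f : Aut M, a' = f \o a].

Record formal_comb (T : Type) := FormalComb {
  comb_size : nat;
  comb_weight : 'I_comb_size -> R;
  comb_point : 'I_comb_size -> T }.

Arguments comb_weight {T} v i : rename.
Arguments comb_point {T} v i : rename.

Definition convex_comb (T : Type) (A : set T) : set (formal_comb T) :=
  [set v | [/\ (0 < comb_size v)%N,
               forall i, A (comb_point v i),
               forall i, 0 <= comb_weight v i <= 1 &
               \sum_i comb_weight v i = 1]].

(* An automorphism taking b to b' when there is one; its effect on tuples in the
   range of b does not depend on the choice (transporterE). *)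
Definition transporter m (b b' : 'I_m -> M) : Aut M :=
  xget 1%g [set s : Aut M | s \o b = b'].

Definition comb_circ m n (b : 'I_m -> M) (v : formal_comb ('I_m -> M))
    (a' : 'I_n -> M) : formal_comb ('I_n -> M) :=
  FormalComb (comb_weight v)
    (fun i => transporter b (comb_point v i) \o a').

Lemma transporterE m n (b b' : 'I_m -> M) (a' : 'I_n -> M)
    (s : Aut M) : range a' `<=` range b -> s \o b = b' ->
  transporter b b' \o a' = s \o a'.
Proof.
move=> ab sb; have tb : transporter b b' \o b = b'.
  by apply: (@xgetPex (Aut M) 1%g [set s : Aut M | s \o b = b']); exists s.
apply/funext => i /=; have [j _ <-] := ab _ (imageT a' i).
by rewrite -[LHS]/((transporter b b' \o b) j) tb -sb.
Qed.

(* Colourings are total functions on tuples; only their values on copies of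
   the coloured tuple are ever used. *)
Definition colour n r (c : ('I_n -> M) -> {ffun 'I_r -> bool})
    (w : formal_comb ('I_n -> M)) : 'rV[R]_r :=
  \row_j \sum_i comb_weight w i * (c (comb_point w i) j)%:R.

(* The norm of 'rV[R]_r is the supremum norm mx_norm. *)
Definition ECRP_at (eps : R) : Prop :=
  forall (n : nat) (a : 'I_n -> M) (B : set M) (m : nat) (b : 'I_m -> M),
    finite_set B -> range b = B -> range a `<=` B ->
  forall r : nat,
  exists C : set M, [/\ finite_set C, B `<=` C &
    forall c : ('I_n -> M) -> {ffun 'I_r -> bool},
    exists v : formal_comb ('I_m -> M), convex_comb (copies C b) v /\
      forall a' a'' : 'I_n -> M, copies B a a' -> copies B a a'' ->
        `|colour c (comb_circ b v a') - colour c (comb_circ b v a'')| <= eps].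

Definition ECRP : Prop := forall eps : R, 0 < eps -> ECRP_at eps.

Definition strong_ECRP : Prop := ECRP_at 0.

End convex_ramsey.

(* Main.v *)
Require Import Defs.
From HB Require Import structures.
From mathcomp Require Import all_boot all_order all_algebra.
From mathcomp Require Import finmap.
From mathcomp Require Import all_classical all_reals all_analysis.
From mathcomp Require Import lra.

(** Amenability gives the strong property. For a colouring [c], an invariant
    measure on the orbit closure of [c] in the compact space of colourings
    determines, by restricting colourings to the copies inside [B], weights on
    finitely many patterns. Each pattern of positive weight is realised by some
    [g c], so the weights become a convex combination of copies [g^-1 b], and
    invariance of the measure says that all copies of [a] in [B] get exactly
    the same mean colour. Compactness of the space of colourings bounds the
    copies needed, hence yields a finite [C].

    Conversely, let [Aut M] act on a compact Hausdorff space [X] with a base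
    point [x0]. If [K] is closed in an open [U], the stabiliser of some finite
    tuple [a] moves [K] inside [U]; colouring [g a] according to whether
    [g^-1 x0] can be taken in [K], the ECRP yields finitely supported
    probabilities [nu] with [nu (h K) <= nu U + e] for finitely many [h], [K],
    [U]. A limit is a finitely additive probability [m] on all subsets of [X]
    with [m (h K) <= m U]. Regularising [m] (supremum over closed sets inside an open
    set, then infimum over open sets around a set) gives an outer measure for
    which open sets are Caratheodory measurable, and the inequality becomes
    invariance. No integration of continuous functions is involved. *)

Set Implicit Arguments.
Unset Strict Implicit.
Unset Printing Implicit Defensive.

Import Order.TTheory GRing.Theory Num.Theory.
Import numFieldNormedType.Exports.

Local Open Scope classical_set_scope.
Local Open Scope ring_scope.

Local Arguments comb_weight {R T} v i : rename.
Local Arguments comb_point {R T} v i : rename.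

(** * Regularisation of a finitely additive probability *)

Section finitely_additive.
Context {R : realType} {T : Type}.

Definition fa_probability (m : set T -> R) :=
  [/\ m [set: T] = 1, forall A, 0 <= m A &
      forall A B, A `&` B = set0 -> m (A `|` B) = m A + m B].

Variable m : set T -> R.
Hypothesis mP : fa_probability m.

Lemma fa_probability0 : m set0 = 0.
Proof.
case: mP => _ _ mU; have := mU set0 set0 (setI0 _); rewrite setU0.
by move=> e; lra.
Qed.

Lemma le_fa_probability A B : A `<=` B -> m A <= m B.
Proof.
case: mP => _ m0 mU AB; rewrite -(setDUK AB) mU ?lerDl//.
by rewrite setDE setICA setICr setI0.
Qed.

Lemma fa_probability_le1 A : m A <= 1.
Proof. by case: mP => <- _ _; exact: le_fa_probability. Qed.

Lemma fa_probabilityU_le A B : m (A `|` B) <= m A + m B.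
Proof.
case: mP => _ m0 mU.
have -> : A `|` B = A `|` (B `\` A).
  by rewrite setDE setUIr setUCr setIT.
rewrite mU; last by rewrite setDE setICA setICr setI0.
by rewrite lerD2l le_fa_probability.
Qed.

End finitely_additive.

(** * Separation of closed sets in a compact Hausdorff space *)

Section normal_separation.
Context {X : topologicalType}.
Hypotheses (hX : hausdorff_space X) (cX : compact [set: X]).

Lemma closed_shrink (K U : set X) : closed K -> open U -> K `<=` U ->
  exists V, [/\ open V, K `<=` V & closure V `<=` U].
Proof.
move=> cK oU KU.
have [W KW WU] : filter_from (set_nbhs K) closure U.
  by apply: (compact_normal hX cX) => //; apply/set_nbhsP; exists U; split.
have [V [oV KV VW]] := (set_nbhsP _ _).1 KW.
by exists V; split => //; exact: subset_trans (closureS VW) WU.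
Qed.

(** Normality puts an open [W] around [K] minus [V] with [closure W] inside [U]; cutting [K] along
    [W] gives the two pieces. They may overlap, which is harmless for the subadditivity they
    serve. *)
Lemma closed_splitU (K U V : set X) : closed K -> open U -> open V ->
  K `<=` U `|` V ->
  exists A B, [/\ closed A, closed B, A `<=` U, B `<=` V & K = A `|` B].
Proof.
move=> cK oU oV KUV.
have cKU : closed (K `\` V).
  by rewrite setDE; apply: closedI => //; exact: open_closedC.
have KVU : K `\` V `<=` U by move=> x [/KUV[]].
have [W [oW KW WU]] := closed_shrink cKU oU KVU.
exists (K `&` closure W), (K `\` W); split.
- by apply: closedI => //; exact: closed_closure.
- by rewrite setDE; apply: closedI => //; exact: open_closedC.
- by move=> x [_ /WU].
- by move=> x [Kx nWx]; apply: contrapT => nVx; apply: nWx; exact: KW.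
- apply/seteqP; split=> [x Kx|x [[]|[]]//].
  have [Wx|nWx] := pselect (W x); last by right.
  by left; split => //; exact: subset_closure.
Qed.

End normal_separation.

Section outer_content.
Context {R : realType} {X : topologicalType}.
Variable m : set X -> R.
Local Open Scope ereal_scope.

(** Since [m] is only finitely additive, [m U] can exceed this supremum. Restricting to closed,
    hence compact, subsets is what later yields countable subadditivity. *)
Definition open_content (U : set X) : \bar R :=
  ereal_sup [set (m K)%:E | K in [set K | closed K /\ K `<=` U]].

Definition outer_content (A : set X) : \bar R :=
  ereal_inf [set open_content U | U in [set U | open U /\ A `<=` U]].

Lemma open_content_ge (K U : set X) : closed K -> K `<=` U ->
  (m K)%:E <= open_content U.
Proof. by move=> cK KU; apply: ereal_sup_ubound; exists K. Qed.

Lemma le_open_content (U V : set X) : U `<=` V ->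
  open_content U <= open_content V.
Proof.
move=> UV; apply: ereal_sup_le => _ [K [cK KU] <-].
by exists K => //; split => //; exact: subset_trans UV.
Qed.

Lemma le_outer_content : {homo outer_content : A B / A `<=` B >-> A <= B}.
Proof.
move=> A B AB; apply: ereal_inf_le_tmp => _ [U [oU BU] <-].
by exists U => //; split => //; exact: subset_trans BU.
Qed.

Lemma outer_content_open (U : set X) : open U ->
  outer_content U = open_content U.
Proof.
move=> oU; apply/eqP; rewrite eq_le; apply/andP; split.
  by apply: ereal_inf_lbound; exists U => //; split.
by apply: le_ereal_inf_tmp => _ [V [oV UV] <-]; exact: le_open_content.
Qed.

Hypothesis mP : fa_probability m.

Lemma open_content_ge0 (U : set X) : 0 <= open_content U.
Proof.
by have := open_content_ge closed0 (@sub0set _ U); rewrite (fa_probability0 mP).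
Qed.

Lemma open_content_le1 (U : set X) : open_content U <= 1.
Proof.
by apply: ge_ereal_sup => _ [K _ <-]; rewrite lee_fin (fa_probability_le1 mP).
Qed.

Lemma open_content_fin (U : set X) : open_content U \is a fin_num.
Proof.
rewrite ge0_fin_numE ?open_content_ge0//.
by rewrite (le_lt_trans (open_content_le1 U))// ltry.
Qed.

Lemma open_contentT : open_content [set: X] = 1.
Proof.
apply/eqP; rewrite eq_le open_content_le1/=.
by have := open_content_ge closedT (@subsetT _ [set: X]); case: mP => ->.
Qed.

Lemma open_content0 : open_content set0 = 0.
Proof.
apply/eqP; rewrite eq_le open_content_ge0 andbT.
apply: ge_ereal_sup => _ [K [_ K0] <-].
by move: K0; rewrite subset0 => ->; rewrite (fa_probability0 mP).
Qed.

Lemma outer_content_ge0 (A : set X) : 0 <= outer_content A.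
Proof. by apply: le_ereal_inf_tmp => _ [U _ <-]; exact: open_content_ge0. Qed.

Lemma outer_content_fin (A : set X) : outer_content A \is a fin_num.
Proof.
rewrite ge0_fin_numE ?outer_content_ge0//.
rewrite (le_lt_trans (le_outer_content (@subsetT _ A)))//.
by rewrite outer_content_open ?open_contentT ?ltry//; exact: openT.
Qed.

Lemma outer_content0 : outer_content set0 = 0.
Proof. by rewrite outer_content_open ?open_content0//; exact: open0. Qed.

Lemma outer_content_approx (A : set X) (e : R) : (0 < e)%R ->
  exists U, [/\ open U, A `<=` U & open_content U <= outer_content A + e%:E].
Proof.
move=> e0; have [_ [U [oU AU] <-] /ltW UA] :=
  lb_ereal_inf_adherent e0 (outer_content_fin A).
by exists U.
Qed.

Lemma open_content_approx (U : set X) (e : R) : (0 < e)%R ->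
  exists K, [/\ closed K, K `<=` U & open_content U <= (m K + e)%:E].
Proof.
move=> e0; have [_ [K [cK KU] <-] /ltW UA] :=
  ub_ereal_sup_adherent e0 (open_content_fin U).
by exists K; split => //; rewrite EFinD -leeBlDr.
Qed.

Hypotheses (hX : hausdorff_space X) (cX : compact [set: X]).

Lemma open_contentU (U V : set X) : open U -> open V ->
  open_content (U `|` V) <= open_content U + open_content V.
Proof.
move=> oU oV; apply: ge_ereal_sup => _ [K [cK KUV] <-].
have [A [B [cA cB AU BV ->]]] := closed_splitU hX cX cK oU oV KUV.
apply: (@le_trans _ _ (m A + m B)%:E).
  by rewrite lee_fin fa_probabilityU_le.
by rewrite EFinD; apply: leeD; exact: open_content_ge.
Qed.

Lemma open_content_bigsetU (U : (set X)^nat) n : (forall i, open (U i)) ->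
  open_content (\big[setU/set0]_(i < n) U i) <=
  \sum_(i < n) open_content (U i).
Proof.
move=> oU; elim: n => [|n IH]; first by rewrite !big_ord0 open_content0.
rewrite !big_ord_recr/=; apply: (le_trans (open_contentU _ _)) => //.
  by rewrite -bigcup_mkord; exact: bigcup_open.
exact: leeD2r.
Qed.

(** A closed [K] in the union is compact, so it already lies in a finite partial union, where finite
    subadditivity applies. *)
Lemma open_content_bigcup (U : (set X)^nat) : (forall i, open (U i)) ->
  open_content (\bigcup_i U i) <= \sum_(i <oo) open_content (U i).
Proof.
move=> oU; apply: ge_ereal_sup => _ [K [cK KU] <-].
have [n Kn] : exists n, K `<=` \big[setU/set0]_(i < n) U i.
  have : compact K by apply: subclosed_compact cX _.
  move=> /compact_near_coveringP/(_ nat \oo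
    (fun n x => (\big[setU/set0]_(i < n) U i) x)) [].
    move=> x /KU[i _ Uix]; exists (U i, [set n | (i < n)%N]).
      by split => /=; [exact: open_nbhs_nbhs|exists i.+1].
    by move=> [y n] /= [Uy ltin]; rewrite -bigcup_mkord; exists i.
  by move=> n _ Kn; exists n; apply: Kn => /=.
apply: (le_trans (open_content_ge cK Kn)).
apply: (le_trans (open_content_bigsetU _ oU)).
rewrite -(big_mkord xpredT (fun i => open_content (U i))).
by apply: nneseries_lim_ge => i _ _; exact: open_content_ge0.
Qed.

Lemma outer_content_sigma_subadditive : sigma_subadditive outer_content.
Proof.
move=> F; apply/lee_addgt0Pr => e e0.
have eps i : (0 < e / (2 ^ i.+1)%:R)%R by rewrite divr_gt0// ltr0n expn_gt0.
pose U i := sval (cid (outer_content_approx (F i) (eps i))).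
have UP i : [/\ open (U i), F i `<=` U i &
    open_content (U i) <= outer_content (F i) + (e / (2 ^ i.+1)%:R)%:E].
  exact: svalP (cid (outer_content_approx (F i) (eps i))).
apply: le_trans (epsilon_trick _ (fun i => outer_content_ge0 (F i)) (ltW e0)).
apply: (@le_trans _ _ (\sum_(i <oo) open_content (U i))).
  apply: (le_trans _ (open_content_bigcup _)); last by move=> i; case: (UP i).
  apply: ereal_inf_lbound; exists (\bigcup_i U i) => //; split.
    by apply: bigcup_open => i _; case: (UP i).
  by apply: subset_bigcup => i _; case: (UP i).
by apply: lee_nneseries => i *; [exact: open_content_ge0|case: (UP i)].
Qed.

(** Take an open [W] around [A], a closed [K] nearly filling the part of [W] in [U], then a closed
    [L] nearly filling [W] minus [K]. Removing [K] rather than [U] keeps this last set open, and it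
    still covers [A] outside [U]. As [K] and [L] are disjoint in [W], additivity of [m] bounds
    [m K + m L] by the content of [W]; each of the three choices costs [e / 3]. *)
Lemma open_caratheodory (U : set X) : open U ->
  forall A, outer_content (A `&` U) + outer_content (A `&` ~` U) <=
    outer_content A.
Proof.
move=> oU A; apply/lee_addgt0Pr => e e0.
have e3 : (0 < e / 3)%R by rewrite divr_gt0.
have [W [oW AW WA]] := outer_content_approx A e3.
have [K [cK KWU Ke]] := open_content_approx (W `&` U) e3.
have oWK : open (W `&` ~` K) by apply: openI => //; exact: closed_openC.
have [L [cL LW Le]] := open_content_approx (W `&` ~` K) e3.
apply: (@le_trans _ _ ((m K + e / 3)%:E + (m L + e / 3)%:E)).
  apply: leeD.
    rewrite (le_trans _ Ke)// -outer_content_open; last exact: openI.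
    by apply: le_outer_content; exact: setSI.
  rewrite (le_trans _ Le)// -outer_content_open//.
  apply: le_outer_content; apply: setISS => //.
  by apply: subsetC => x /KWU[].
apply: (@le_trans _ _ (open_content W + (e / 3 + e / 3)%:E)).
  rewrite -EFinD.
  have -> : (m K + e / 3 + (m L + e / 3) = m (K `|` L) + (e / 3 + e / 3))%R.
    case: mP => _ _ ->; first by lra.
    by apply/disjoints_subset => x Kx /LW[].
  rewrite EFinD; apply: leeD2r; apply: open_content_ge; first exact: closedU.
  by move=> x [/KWU[]|/LW[]].
apply: (le_trans (leeD2r _ WA)).
by rewrite -addeA -EFinD; have -> : (e / 3 + (e / 3 + e / 3) = e)%R by lra.
Qed.

End outer_content.

Section outer_content_probability.
Context {R : realType} {X : ptopologicalType}.
Variable m : set X -> R.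
Hypotheses (mP : fa_probability m).
Hypotheses (hX : hausdorff_space X) (cX : compact [set: X]).

Lemma outer_content_probability :
  exists mu : probability (borel X) R, forall A, mu A = outer_content m A.
Proof.
pose om : {outer_measure set X -> \bar R} := HB.pack (outer_content m)
  (isOuterMeasure.Build R X (outer_content m) (outer_content0 mP)
    (outer_content_ge0 mP) (@le_outer_content _ _ m)
    (outer_content_sigma_subadditive mP hX cX)).
(* The Caratheodory measurable sets form a sigma-algebra, so it is enough to treat open sets. *)
have borel_cara (A : set (borel X)) : measurable A -> om.-caratheodory A.
  apply: smallest_sub.
    exact: (@sigma_algebra_measurable _ (caratheodory_type om)).
  move=> U oU; apply: le_caratheodory_measurable => B.
  exact: open_caratheodory.
have sadd : semi_sigma_additive (outer_content m : set (borel X) -> \bar R).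
  move=> F mF tF mUF.
  by apply: (@caratheodory_measure_sigma_additive _ _ om) => // [i|];
    exact: borel_cara.
pose mu0 : {measure set (borel X) -> \bar R} := HB.pack
  (outer_content m : set (borel X) -> \bar R)
  (isMeasure.Build _ (borel X) R (outer_content m : set (borel X) -> \bar R)
    (outer_content0 mP) (outer_content_ge0 mP) sadd).
have mu0T : mu0 setT = 1%E.
  rewrite -(open_contentT mP); apply: outer_content_open; exact: openT.
pose mu : probability (borel X) R := HB.pack
  (Measure.sort mu0) (Measure.class mu0)
  (Measure_isProbability.Build _ _ R mu0 mu0T).
by exists mu.
Qed.

Lemma closed_borel (K : set X) : closed K -> measurable (K : set (borel X)).
Proof.
move=> cK; rewrite -(setCK K); apply: measurableC.
by apply: sub_sigma_algebra; exact: closed_openC.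
Qed.

(** Outer regularity is built into the infimum. Inner regularity follows by complements: an open set
    slightly larger than the complement of [A] has a compact complement inside [A]. *)
Lemma outer_content_regular (mu : probability (borel X) R) :
  (forall A, mu A = outer_content m A) -> regular_measure mu.
Proof.
move=> muE.
have outer (A : set X) :
    mu A = ereal_inf [set mu U | U in [set U : set X | open U /\ A `<=` U]].
  rewrite muE; congr ereal_inf; apply/seteqP; split=> _ [U [oU AU] <-];
  by exists U => //; rewrite muE outer_content_open.
move=> A mA; split; first exact: outer.
apply/eqP; rewrite eq_le; apply/andP; split; last first.
  apply: ge_ereal_sup => _ [K [cK KA] <-].
  apply: le_measure => //; rewrite inE//.
  by apply: closed_borel; exact: compact_closed.
apply/lee_addgt0Pr => e e0.
have [U [oU AU Ue]] := outer_content_approx mP (~` A) e0.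
have mU : measurable (U : set (borel X)) by exact: sub_sigma_algebra.
have cU : closed (~` U) by exact: open_closedC.
apply: (@le_trans _ _ (mu (~` U) + e%:E)%E); last first.
  apply: leeD2r; apply: ereal_sup_ubound; exists (~` U) => //; split.
    exact: subclosed_compact cX _.
  exact: subsetCl.
have := Ue; rewrite -outer_content_open// -!muE !probability_setC//.
rewrite -(fineK (fin_num_measure mu _ mA)) -(fineK (fin_num_measure mu _ mU)).
by rewrite -!EFinB -!EFinD !lee_fin => ?; lra.
Qed.

End outer_content_probability.

(** * Invariance of the regularised content under the action *)

Section content_invariance.
Context {R : realType} {X : topologicalType} (G : topologicalGroupType).
Variables (act : G -> X -> X) (m : set X -> R).
Hypotheses (hX : hausdorff_space X) (cX : compact [set: X]).
Hypotheses (actP : continuous_action act) (mP : fa_probability m).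
Hypothesis m_act : forall g K U, closed K -> open U -> K `<=` U ->
  m (act g @^-1` K) <= m U.

Lemma act_continuous g : continuous (act g).
Proof.
case: actP => _ _ cact x.
apply: (@continuous_comp _ _ _ (fun y => (g, y)) (fun p => act p.1 p.2)).
  by apply: cvg_pair; [exact: cvg_cst|exact: cvg_id].
exact: cact.
Qed.

Lemma actK g : cancel (act g) (act g^-1%g).
Proof. by case: actP => act1 actM _ x; rewrite -actM mulVg act1. Qed.

Lemma actVK g : cancel (act g^-1%g) (act g).
Proof. by case: actP => act1 actM _ x; rewrite -actM mulgV act1. Qed.

Lemma open_act g U : open U -> open (act g @^-1` U).
Proof. by move=> oU; apply: open_comp => // x _; exact: act_continuous. Qed.

Lemma closed_act g K : closed K -> closed (act g @^-1` K).
Proof.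
by move=> cK; apply: preimage_closed => // x _; exact: act_continuous.
Qed.

(** The translate [L] of [K] by [g] is closed in [U]. The bound [m K <= m V] is useful only for an
    open [V] with [closure V] inside [U], because the content of [U] sees closed subsets and may be
    smaller than [m U]. *)
Lemma open_content_act g U : open U ->
  (open_content m (act g @^-1` U) <= open_content m U)%E.
Proof.
move=> oU; apply: ge_ereal_sup => _ [K [cK KU] <-].
pose L := act g^-1%g @^-1` K.
have cL : closed L by exact: closed_act.
have LU : L `<=` U by move=> x /KU /=; rewrite actVK.
have [V [oV LV VU]] := closed_shrink hX cX cL oU LU.
apply: le_trans (open_content_ge m (@closed_closure _ V) VU).
rewrite lee_fin (le_trans _ (le_fa_probability mP (@subset_closure _ V)))//.
rewrite (le_trans _ (m_act g cL oV LV))//.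
by apply: le_fa_probability => // x Kx; rewrite /L /= actK.
Qed.

Lemma outer_content_act_le g A :
  (outer_content m (act g @^-1` A) <= outer_content m A)%E.
Proof.
apply: le_ereal_inf_tmp => _ [U [oU AU] <-].
apply: le_trans (open_content_act g oU).
apply: ereal_inf_lbound; exists (act g @^-1` U) => //; split.
  exact: open_act.
exact: preimage_subset.
Qed.

Lemma outer_content_act g A :
  outer_content m (act g @^-1` A) = outer_content m A.
Proof.
apply/eqP; rewrite eq_le outer_content_act_le/=.
have := outer_content_act_le g^-1%g (act g @^-1` A).
have -> // : act g^-1%g @^-1` (act g @^-1` A) = A.
by apply/seteqP; split=> x /=; rewrite actVK.
Qed.

End content_invariance.

(** * Limits of finitely supported probabilities *)

Section convex_mass.
Context {R : realType} {T : Type}.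

Definition comb_mass (v : formal_comb R T) (A : set T) : R :=
  \sum_i comb_weight v i * (comb_point v i \in A)%:R.

Lemma comb_mass_fa (v : formal_comb R T) :
  convex_comb setT v -> fa_probability (comb_mass v).
Proof.
move=> [_ _ v01 v1]; split.
- by rewrite /comb_mass -[RHS]v1; apply: eq_bigr => i _; rewrite in_setT mulr1.
- by move=> A; apply: sumr_ge0 => i _; rewrite mulr_ge0//; case/andP: (v01 i).
- move=> A B AB0; rewrite /comb_mass -big_split/=; apply: eq_bigr => i _.
  rewrite -mulrDr in_setU; congr (_ * _).
  have : comb_point v i \in A `&` B = false by rewrite AB0 in_set0.
  rewrite in_setI; case: (_ \in A); case: (_ \in B) => //=;
  by rewrite ?addr0 ?add0r.
Qed.

End convex_mass.

Section fa_limit.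
Context {R : realType} {T : Type}.
Implicit Types D : set (set T * set T).
Local Notation E := (prod_topology (fun _ : set T => R)).

Lemma eval_continuous_ptws (A : set T) : continuous ((fun m => m A) : E -> R).
Proof. exact: (@proj_continuous _ (fun _ : set T => R) A). Qed.

(** Each defining condition involves finitely many evaluations, which are continuous for the product
    topology. *)
Lemma closed_fa_probability : closed (@fa_probability R T : set E).
Proof.
have -> : (@fa_probability R T : set E) =
    [set m | m [set: T] = 1] `&`
    \bigcap_A [set m | 0 <= m A] `&`
    \bigcap_(AB in [set AB | AB.1 `&` AB.2 = set0])
      [set m | m (AB.1 `|` AB.2) - (m AB.1 + m AB.2) = 0].
  apply/seteqP; split=> [m [m1 m0 mU]|m [[m1 m0] mU]].
    split; first by split => // A _; exact: m0.
    by move=> [A B] /= AB0; rewrite mU// subrr.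
  split => // [A|A B AB0]; first exact: m0.
  by apply/eqP; rewrite -subr_eq0; apply/eqP; exact: (mU (A, B)).
apply: closedI; first apply: closedI.
- apply: (@preimage_closed _ _ (fun m : E => m setT) [set 1]).
    by move=> ? _; exact: eval_continuous_ptws.
  exact: closed_eq.
- apply: closed_bigI => A _.
  apply: (@preimage_closed _ _ (fun m : E => m A) [set x | 0 <= x]).
    by move=> ? _; exact: eval_continuous_ptws.
  exact: closed_ge.
- apply: closed_bigI => -[A B] _ /=.
  apply: (@preimage_closed _ _
    (fun m : E => m (A `|` B) - (m A + m B)) [set 0]).
    move=> m _; have := cvgB (@eval_continuous_ptws (A `|` B) m)
      (cvgD (@eval_continuous_ptws A m) (@eval_continuous_ptws B m)).
    exact.
  exact: closed_eq.
Qed.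

(** The sets [S p] of probabilities meeting finitely many constraints up to a slack generate a
    proper filter on the cube of functions into [0, 1]. Tychonoff gives a cluster point; it
    satisfies every constraint with every positive slack, hence with none. *)
Lemma fa_probability_limit D :
  (forall (e : R) n (A B : 'I_n -> set T), 0 < e ->
    (forall i, D (A i, B i)) ->
    exists2 m, fa_probability m & forall i, m (A i) <= m (B i) + e) ->
  exists2 m : set T -> R, fa_probability m &
    forall A B, D (A, B) -> m A <= m B.
Proof.
move=> approx.
pose S (p : R * {n & 'I_n -> set T * set T}) : set E := [set m |
  fa_probability m /\
  forall i, m (projT2 p.2 i).1 <= m (projT2 p.2 i).2 + p.1].
pose J := [set p : R * {n & 'I_n -> set T * set T} |
  0 < p.1 /\ forall i, D (projT2 p.2 i)].
pose F := filter_from J S.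
pose p0 : R * {n & 'I_n -> set T * set T} :=
  (1, existT (fun n => 'I_n -> set T * set T) 0%N (fun=> (set0, set0))).
have Jp0 : J p0 by split => //= -[].
have FF : ProperFilter F.
  apply: filter_from_proper; last first.
    move=> [e [n f]] [/= e0 Df].
    have [||m mP mf] := approx e n (fst \o f) (snd \o f) => //.
      by move=> i /=; rewrite -surjective_pairing.
    by exists m.
  apply: filter_from_filter.
    by exists p0.
  (* Two demands are met jointly by concatenating the constraint lists and taking the smaller
     slack. *)
  move=> [e1 [n1 f1]] [e2 [n2 f2]] [/= e10 Df1] [/= e20 Df2].
  exists (Num.min e1 e2, existT (fun n => 'I_n -> set T * set T) (n1 + n2)%N
    (fun i => match fintype.split i with inl i => f1 i | inr i => f2 i end)).
    split; first by rewrite /= lt_min e10.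
    by move=> i /=; case: fintype.split.
  move=> m [/= mP mf]; split; split => //= i.
    have := mf (lshift n2 i); rewrite (unsplitK (inl i)) => /le_trans; apply.
    by rewrite lerD2l ge_min lexx.
  have := mf (rshift n1 i); rewrite (unsplitK (inr i)) => /le_trans; apply.
  by rewrite lerD2l ge_min lexx orbT.
have cE : compact [set m : E | forall A, `[0, 1]%classic (m A)].
  apply: (@tychonoff (set T) (fun=> R) (fun=> `[0, 1]%classic)) => A.
  exact: segment_compact.
have [|m [_ mF]] := cE F FF.
  exists p0 => //.
  move=> m [mP _] A /=; rewrite in_itv/= (fa_probability_le1 mP) andbT.
  by case: mP.
have mS p : J p -> closure (S p) m.
  by move=> Jp V; apply: mF; exists p.
exists m.
  have : closure (@fa_probability R T : set E) m.
    apply: (@closureS _ (S p0)); first by move=> ? [].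
    exact: mS.
  by rewrite -(closure_id _).1//; exact: closed_fa_probability.
move=> A B DAB; apply/ler_addgt0Pr => e e0.
pose p : R * {n & 'I_n -> set T * set T} :=
  (e, existT (fun n => 'I_n -> set T * set T) 1%N (fun=> (A, B))).
have clAB : closed [set m : E | m A - m B <= e].
  apply: (@preimage_closed _ _ (fun m : E => m A - m B) [set x | x <= e]).
    move=> n _; have := cvgB (@eval_continuous_ptws A n)
      (@eval_continuous_ptws B n).
    exact.
  exact: closed_le.
suff : closure [set m : E | m A - m B <= e] m.
  by rewrite -(closure_id _).1//= lerBlDl.
apply: (@closureS _ (S p)); last by apply: mS; split.
by move=> n [_ /(_ ord0)] /=; rewrite lerBlDl.
Qed.

End fa_limit.

(** * From the ECRP to amenability *)

Section stabilizers.
Context {L : language} {M : structure L}.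

(** The stabilisers of finite tuples generate a filter [F]. It converges to the identity, since
    convergence is tested one point [x] at a time and there the stabiliser of [x] suffices. *)
Lemma nbhs1_aut (V : set (Aut M)) : nbhs (1%g : Aut M) V ->
  exists n (a : 'I_n -> M), forall g : Aut M, g \o a = a -> V g.
Proof.
pose N := {ptws M -> discrete_topology {classic M}}.
pose F : set_system (Aut M) := [set W | exists n (a : 'I_n -> M),
  forall g : Aut M, g \o a = a -> W g].
have FF : Filter F.
  split.
  - by have a0 : 'I_0 -> M by [case]; exists 0%N, a0.
  - move=> P Q [n1 [a1 P1]] [n2 [a2 P2]].
    exists (n1 + n2)%N, (fun i => match fintype.split i with
      inl i => a1 i | inr i => a2 i end) => g ga.
    split; [apply: P1|apply: P2]; apply/funext => i /=.
      by have := congr1 (@^~ (lshift n2 i)) ga; rewrite /= (unsplitK (inl i)).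
    by have := congr1 (@^~ (rshift n1 i)) ga; rewrite /= (unsplitK (inr i)).
  - by move=> P Q PQ [n [a aP]]; exists n, a => g /aP /PQ.
have FN : @Filter N ((@aut_fun L M : Aut M -> N) @ F) by exact: fmap_filter.
have cvF : ((@aut_fun L M : Aut M -> N) @ F) --> (aut_fun (1%g : Aut M) : N).
  apply/(@cvg_sup _ _ _ _ _ FN) => x U [_ [[W oW <-] /= Wx WU]].
  exists 1%N, (fun=> x) => g gx; apply: WU => /=.
  by have := congr1 (@^~ ord0) gx => /= ->.
move=> [_ [[W oW <-] W1 WV]].
have [n [a aW]] := cvF W (open_nbhs_nbhs (conj oW W1)).
by exists n, a => g /aW /WV.
Qed.

(** This is the tube lemma at the identity: by compactness of [K i] and joint continuity, a whole
    neighbourhood of 1 moves [K i] into [U i]. *)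
Lemma stabilizer_act (X : topologicalType) (act : Aut M -> X -> X) r
    (K U : 'I_r -> set X) : continuous_action act ->
  (forall i, compact (K i)) -> (forall i, open (U i)) ->
  (forall i, K i `<=` U i) ->
  exists n (a : 'I_n -> M), forall g : Aut M, g \o a = a ->
    forall i, K i `<=` act g @^-1` U i.
Proof.
move=> [act1 actM cact] cK oU KU.
apply: (@nbhs1_aut [set g | forall i, K i `<=` act g @^-1` U i]).
apply: (@filter_forall _ _ (fun i => [set g | K i `<=` act g @^-1` U i]) _
  (nbhs_filter (1%g : Aut M))) => i.
have /compact_near_coveringP := cK i; apply => x /KU Ux.
have : nbhs (act 1%g x) (U i) by rewrite act1; exact: open_nbhs_nbhs.
move=> /(cact (1%g, x)) [[P Q] /= [P1 Qx] PQ].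
by exists (Q, P) => // -[y g] /= [Qy Pg]; exact: (PQ (g, y)).
Qed.

End stabilizers.

Lemma ler_coord_mx_norm (R : realType) r (x : 'rV[R]_r) j : `|x ord0 j| <= `|x|.
Proof.
rewrite /Num.norm/= mx_normrE.
exact: (le_bigmax _ (fun ij : 'I_1 * 'I_r => `|x ij.1 ij.2|) (ord0, j)).
Qed.

(** For each [j], the ECRP makes the mean colours of [a] and of its translate by the inverse of
    [g j] agree up to [e]. The first is at most the mass of [U j], the second at least that of the
    preimage of [K j]. *)
Lemma ECRP_approx (R : realType) (L : language) (M : structure L)
    (X : topologicalType) (act : Aut M -> X -> X) (x0 : X) (e : R) r
    (K U : 'I_r -> set X) (g : 'I_r -> Aut M) :
  ECRP R M -> continuous_action act -> 0 < e ->
  (forall i, compact (K i)) -> (forall i, open (U i)) ->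
  (forall i, K i `<=` U i) ->
  exists2 v : formal_comb R X, convex_comb setT v &
    forall i, comb_mass v (act (g i) @^-1` K i) <= comb_mass v (U i) + e.
Proof.
move=> ecrp actP e0 cK oU KU.
have [n [a aP]] := stabilizer_act actP cK oU KU.
case: actP => act1 actM _.
(* The block [None] of [b] is [a] itself; the block [Some i] is the translate of [a] by the inverse
   of [g i]. *)
pose b (p : 'I_#|{: option 'I_r * 'I_n}|) : M :=
  let: (o, j) := enum_val p in
  if o is Some i then ((g i)^-1)%g (a j) else a j.
have bS i j : range b (((g i)^-1)%g (a j)).
  by exists (enum_rank (Some i, j)) => //; rewrite /b enum_rankK.
have bN j : range b (a j).
  by exists (enum_rank (None, j)) => //; rewrite /b enum_rankK.
have ab : range a `<=` range b by move=> _ [j _ <-].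
have fb : finite_set (range b) by apply: finite_image; exact: finite_finset.
have [C [_ _ CP]] := ecrp e e0 n a (range b) _ b fb erefl ab r.
(* For t = h a, colour j of t holds if h^-1 x0 is in K j and fails if it is
   outside U j, because two choices of h differ by an element fixing a. *)
pose c (t : 'I_n -> M) : {ffun 'I_r -> bool} := [ffun j =>
  `[< exists h : Aut M, t = h \o a /\ K j (act h^-1%g x0) >]].
have cK1 (h : Aut M) j : K j (act h^-1%g x0) -> c (h \o a) j.
  by move=> Kj; rewrite ffunE; apply/asboolP; exists h.
have cU1 (h : Aut M) j : c (h \o a) j -> U j (act h^-1%g x0).
  rewrite ffunE => /asboolP[h' [hh' Kj]].
  have -> : act h^-1%g x0 = act (h^-1 * h')%g (act h'^-1%g x0).
    by rewrite -actM -mulgA mulgV mulg1.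
  apply: (aP) Kj; apply/funext => k /=.
  rewrite -[LHS]/(aut_inv h ((h' \o a) k)) -hh' /=.
  exact: aut_invK.
have [v [[v0 vC v01 v1] vP]] := CP c.
have vs i : exists s : Aut M, s \o b = comb_point v i.
  by have [_ [s ->]] := vC i; exists s.
pose s i := sval (cid (vs i)).
have sP i : s i \o b = comb_point v i by exact: svalP (cid (vs i)).
(* A copy [s i \o b] becomes the point of the orbit of [x0] given by the inverse of [s i]; any
   choice of [s i] satisfies the two estimates below. *)
exists (FormalComb (comb_weight v) (fun i => act (s i)^-1%g x0)).
  by split.
move=> j.
pose a' : 'I_n -> M := ((g j)^-1)%g \o a.
have a'b : range a' `<=` range b by move=> _ [k _ <-]; exact: bS.
have ca' : copies (range b) a a' by split => //; exists ((g j)^-1)%g.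
have ca : copies (range b) a a.
  by split => //; exists 1%g; apply: funext.
have := le_trans (ler_coord_mx_norm _ j) (vP _ _ ca' ca).
rewrite !mxE ler_norml => /andP[_]; rewrite lerBlDr addrC => va.
apply: (le_trans _ (le_trans va _)).
  apply: ler_sum => i _; have /andP[w0 _] := v01 i.
  apply: ler_wpM2l => //=; rewrite (transporterE a'b (sP i)).
  rewrite ler_nat; case: (boolP (_ \in _)) => // /set_mem /=.
  rewrite -actM => Kj.
  have := @cK1 (s i * (g j)^-1)%g j.
  by rewrite invgM invgK => /(_ Kj) ->.
rewrite lerD2r; apply: ler_sum => i _; have /andP[w0 _] := v01 i.
apply: ler_wpM2l => //=; rewrite (transporterE ab (sP i)).
rewrite ler_nat; case: (boolP (c _ j)) => // /cU1 Uj.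
by rewrite mem_set.
Qed.

Lemma ECRP_amenable (R : realType) (L : language) (M : structure L) :
  ECRP R M -> amenable R (Aut M).
Proof.
move=> ecrp X act cX hX actP.
(* These constraints are exactly the inequalities from which the regularised content inherits
   invariance. *)
pose D := [set AB : set X * set X | exists (g : Aut M) K,
  [/\ closed K, open AB.2, K `<=` AB.2 & AB.1 = act g @^-1` K]].
have [m mP mD] : exists2 m : set X -> R, fa_probability m &
    forall A B, D (A, B) -> m A <= m B.
  apply: fa_probability_limit => e r A U e0 DAU.
  pose g i := sval (cid (DAU i)).
  pose K i := sval (cid (svalP (cid (DAU i)))).
  have gK i : [/\ closed (K i), open (U i), K i `<=` U i &
      A i = act (g i) @^-1` K i].
    exact: svalP (cid (svalP (cid (DAU i)))).
  have [|||v vP vAU] := @ECRP_approx R L M X act point e r K U g ecrp actP e0.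
  - by move=> i; apply: subclosed_compact cX _ => //; case: (gK i).
  - by move=> i; case: (gK i).
  - by move=> i; case: (gK i).
  exists (comb_mass v); first exact: comb_mass_fa.
  by move=> i; have [_ _ _ ->] := gK i.
have [mu muE] := outer_content_probability mP hX cX.
exists mu; split; first by apply: (outer_content_regular _ _ _ muE).
move=> g A mA; rewrite !muE.
apply: (outer_content_act hX cX actP mP) => h K U cK oU KU.
by apply: mD; exists h, K.
Qed.

(** * From amenability to the strong ECRP *)

Lemma continuous_borel (X Y : ptopologicalType) (f : Y -> X)
    (A : set (borel X)) : continuous f -> measurable A ->
  measurable (f @^-1` A : set (borel Y)).
Proof.
move=> cf mA; rewrite -[X in measurable X]setTI.
apply: (@measurability _ _ (borel Y) (borel X) _ f (@open X)) => //.
move=> _ [U oU <-]; rewrite setTI; apply: sub_sigma_algebra.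
by apply: open_comp => // x _; exact: cf.
Qed.

Lemma pushforward_borel (R : realType) (X Y : ptopologicalType) (f : Y -> X)
    (mu : probability (borel Y) R) : continuous f ->
  exists nu : probability (borel X) R, forall A, nu A = mu (f @^-1` A).
Proof.
move=> cf; have mf A := @continuous_borel X Y f A cf.
pose g A := mu (f @^-1` A).
have g0 : g set0 = 0%E by rewrite /g preimage_set0 measure0.
have g_ge0 A : (0 <= g A)%E by exact: measure_ge0.
have g_add : semi_sigma_additive (g : set (borel X) -> \bar R).
  move=> F mF tF mUF; rewrite /g preimage_bigcup.
  apply: measure_semi_sigma_additive => [i||]; first exact: mf.
    apply/trivIsetP => /= i j _ _ ij; rewrite -preimage_setI.
    by move/trivIsetP : tF => /(_ _ _ _ _ ij) ->//; rewrite preimage_set0.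
  by rewrite -preimage_bigcup; exact: mf.
pose nu0 : {measure set (borel X) -> \bar R} := HB.pack
  (g : set (borel X) -> \bar R)
  (isMeasure.Build _ (borel X) R (g : set (borel X) -> \bar R) g0 g_ge0 g_add).
have nu0T : nu0 setT = 1%E.
  by rewrite -[LHS]/(g setT) /g preimage_setT probability_setT.
pose nu : probability (borel X) R := HB.pack
  (Measure.sort nu0) (Measure.class nu0)
  (Measure_isProbability.Build _ _ R nu0 nu0T).
by exists nu.
Qed.

Section set_type_topology.
Context {X : topologicalType} (A : set X).

Lemma set_val_continuous : continuous (set_val : A -> X).
Proof. exact: (@initial_continuous A X set_val). Qed.

Lemma compact_set_type : compact A -> compact [set: A].
Proof.
move=> cA F FF _; have FvF : ProperFilter ((set_val : A -> X) @ F).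
  exact: fmap_proper_filter.
have [|x [Ax Fx]] := cA _ FvF.
  apply: (@filterS _ F _ setT); last exact: filterT.
  by move=> y _; exact: set_valP.
exists (exist _ x (mem_set Ax)); split => // B V FB.
move=> [_ [[W oW <-] Wx WV]].
have [||_ [[y By <-] Wy]] := Fx (set_val @` B) W.
- by apply: (@filterS _ F _ B) => // y By; exists y.
- exact: open_nbhs_nbhs.
by exists y; split => //; exact: WV.
Qed.

Lemma hausdorff_set_type : hausdorff_space X -> hausdorff_space A.
Proof.
move=> hX y z yz; apply: val_inj; apply: hX => U V Uy Vz.
have [t [Ut Vt]] := yz _ _ (set_val_continuous Uy) (set_val_continuous Vz).
by exists (set_val t).
Qed.

End set_type_topology.

(** * Invariant measures carried by an orbit closure *)

Section orbit_measure.
Context {R : realType} {G : topologicalGroupType} {X : ptopologicalType}.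
Variables (act : G -> X -> X) (x0 : X).
Hypotheses (hX : hausdorff_space X) (cX : compact [set: X]).
Hypothesis actP : continuous_action act.

Let A := closure (range (act^~ x0)).

Lemma orbit_closure_act g x : A x -> A (act g x).
Proof.
case: (actP) => _ actM _ Ax U /(act_continuous actP).
move=> /Ax[_ [[h _ <-] Uh]].
by exists (act (g * h)%g x0); split; [exists (g * h)%g|rewrite actM].
Qed.

(** Amenability is applied to the orbit closure and the measure is pushed forward along the
    inclusion. An open set of nonzero measure then meets the closure, hence the orbit itself. *)
Lemma amenable_orbit_measure : amenable R G ->
  exists mu : probability (borel X) R, invariant_measure act mu /\
    forall U, open U -> mu U != 0%E -> exists g, U (act g x0).
Proof.
move=> amG.
have Ax0 : A x0.
  by apply: subset_closure; exists 1%g => //; case: actP.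
pose y0 : A := exist _ x0 (mem_set Ax0).
pose Y : ptopologicalType :=
  HB.pack (set_type A) (isPointed.Build (set_type A) y0).
pose actY (g : G) (y : Y) : Y :=
  exist _ (act g (set_val y)) (mem_set (@orbit_closure_act g _ (set_valP y))).
have actYP : continuous_action actY.
  case: actP => act1 actM cact; split.
  - by move=> y; apply: val_inj; exact: act1.
  - by move=> g h y; apply: val_inj; exact: actM.
  - apply: (@continuous_comp_initial A _ X set_val) => -[g y].
    apply: (@continuous_comp _ _ _ (fun p : G * Y => (p.1, set_val p.2))
      (fun p => act p.1 p.2)); last exact: cact.
    apply: cvg_pair; first exact: cvg_fst.
    apply: (@continuous_comp _ _ _ snd (set_val : Y -> X)).
      exact: cvg_snd.
    exact: set_val_continuous.
have cA : compact A.
  by apply: subclosed_compact cX _ => //; exact: closed_closure.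
have [mu [_ mu_inv]] := amG Y actY (compact_set_type cA)
  (hausdorff_set_type hX) actYP.
have cv : continuous (set_val : Y -> X) by exact: set_val_continuous.
have [nu nuE] := pushforward_borel mu cv.
exists nu; split.
  move=> g B mB; rewrite !nuE.
  apply: (mu_inv g (set_val @^-1` B)).
  exact: (continuous_borel cv mB).
move=> U oU; rewrite nuE => mU.
have [y Uy] : exists y : Y, U (set_val y).
  apply: contrapT => nU; move/eqP: mU; apply.
  rewrite (_ : _ @^-1` U = set0) ?measure0//.
  by apply/seteqP; split => // y Uy; apply: nU; exists y.
have [_ [[g _ <-] Ug]] := set_valP y U (open_nbhs_nbhs (conj oU Uy)).
by exists g.
Qed.

End orbit_measure.

Section colour_space.
Context {L : language} {M : structure L} (n r : nat).

(** Colourings of all [n]-tuples are flattened to one bit per pair of a tuple and a colour index, so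
    that the space is a power of [bool]. *)
Definition colour_space :=
  prod_topology (fun _ : {classic (('I_n -> M) * 'I_r)%type} => bool).

HB.instance Definition _ := Topological.copy colour_space
  (prod_topology (fun _ : {classic (('I_n -> M) * 'I_r)%type} => bool)).
HB.instance Definition _ := isPointed.Build colour_space (fun=> false).

Lemma colour_space_compact : compact [set: colour_space].
Proof.
have := @tychonoff {classic (('I_n -> M) * 'I_r)%type} (fun=> bool) (fun=> setT)
  (fun=> bool_compact).
by congr compact; apply/seteqP; split.
Qed.

Lemma colour_space_hausdorff : hausdorff_space colour_space.
Proof. by apply: hausdorff_product => _; exact: discrete_hausdorff. Qed.

Lemma near_colour (x : colour_space) q : \forall y \near x, y q = x q.
Proof.
have := @proj_continuous {classic (('I_n -> M) * 'I_r)%type} (fun=> bool) q x.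
move=> /(_ [set e | e = x q]); apply.
by rewrite nbhs_principalE; exact/principal_filterP.
Qed.

Lemma colour_space_continuousP (Z : topologicalType) (F : Z -> colour_space) :
  (forall z q, \forall t \near z, F t q = F z q) -> continuous F.
Proof.
move=> FP z; have FF : Filter (F @ z) by exact: fmap_filter.
apply/cvg_sup => q U [_ [[V oV <-] /= Vz VU]].
by apply: filterS (FP z q) => t /= e; apply: VU; rewrite /= e.
Qed.

Definition colour_act (g : Aut M) (x : colour_space) : colour_space :=
  fun q => x ((g^-1)%g \o q.1, q.2).

(** For joint continuity, one coordinate of the result depends only on the inverse of [g] along one
    finite tuple and on one coordinate of [x]. *)
Lemma colour_actP : continuous_action colour_act.
Proof.
split.
- by move=> x; apply/funext => -[t j]; rewrite /colour_act/= invg1.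
- by move=> g h x; apply/funext => -[t j]; rewrite /colour_act/= invgM.
apply: colour_space_continuousP => -[g x] q; rewrite /colour_act/=.
have ng : \forall h \near g, aut_inv h \o q.1 = aut_inv g \o q.1.
  have : \forall h \near g, forall i, aut_inv h (q.1 i) = aut_inv g (q.1 i).
    apply: (@filter_forall _ _
      (fun i => [set h : Aut M | aut_inv h (q.1 i) = aut_inv g (q.1 i)]) _
      (nbhs_filter g)) => i.
    exact: (@invg_continuous (Aut M) g _ (near_aut (aut_inv g) (q.1 i))).
  by apply: filterS => h hg; apply/funext.
exists ([set h | aut_inv h \o q.1 = aut_inv g \o q.1],
  [set y | y (aut_inv g \o q.1, q.2) = x (aut_inv g \o q.1, q.2)]).
  by split => //; exact: near_colour.
move=> [h y] /= [hg <-].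
by rewrite -[LHS]/(y (aut_inv h \o q.1, q.2)) hg.
Qed.

Definition colouring_of (x : colour_space) (t : 'I_n -> M) :
  {ffun 'I_r -> bool} := [ffun j => x (t, j)].

End colour_space.

Lemma probability_preimage_seq d (T : measurableType d) (R : realType)
    (mu : probability T R) (P : eqType) (f : T -> P) (s : seq P) :
  (forall p, measurable (f @^-1` [set p])) -> uniq s ->
  mu (f @^-1` [set p | p \in s]) =
    (\sum_(p <- s) fine (mu (f @^-1` [set p])))%:E.
Proof.
move=> mf; elim: s => [|p s IH] /=.
  move=> _; rewrite big_nil (_ : _ @^-1` _ = set0) ?measure0//.
  by apply/seteqP; split.
move=> /andP[ps us]; rewrite big_cons EFinD -IH// fineK; last first.
  exact: fin_num_measure.
rewrite -measureU//.
- congr (mu _); apply/seteqP; split=> x /=; rewrite inE.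
    by case/orP => [/eqP|]; [left|right].
  by case=> [->|->]; rewrite ?eqxx ?orbT.
- rewrite (_ : _ @^-1` _ = \bigcup_(q in [set` s]) f @^-1` [set q]).
    exact: fin_bigcup_measurable.
  by apply/seteqP; split=> x /=; [exists (f x)|case=> q qs ->].
- by apply/seteqP; split => // x [/= ->] ps'; rewrite ps' in ps.
Qed.

(** * Exact averaging of a single colouring *)

Section strong_ECRP.
Context {R : realType} {L : language} {M : structure L}.
Variables (n r m : nat) (a : 'I_n -> M) (b : 'I_m -> M).

Let X := @colour_space L M n r.
Let P := {ffun {ffun 'I_n -> 'I_m} * 'I_r -> bool}.

(** Tuples inside [range b] are coded by index maps, which makes the type of patterns finite; a
    tuple has several codes when [b] repeats entries. *)
Let pat (y : X) : P := 
  [ffun kj : {ffun 'I_n -> 'I_m} * 'I_r => y (b \o kj.1, kj.2)].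

Let near_pat (x : X) : \forall y \near x, pat y = pat x.
Proof.
have : \forall y \near x, forall kj : {ffun 'I_n -> 'I_m} * 'I_r,
    y (b \o kj.1, kj.2) = x (b \o kj.1, kj.2).
  apply: (@filter_forall _ _
    (fun kj : {ffun 'I_n -> 'I_m} * 'I_r =>
      [set y : X | y (b \o kj.1, kj.2) = x (b \o kj.1, kj.2)]) _
    (nbhs_filter x)) => kj.
  exact: near_colour.
by apply: filterS => y yx; apply/ffunP => kj; rewrite !ffunE.
Qed.

Let open_pat (Q : set P) : open (pat @^-1` Q).
Proof.
rewrite openE => x Qx; apply: filterS (near_pat x) => y /= e.
by rewrite /= e.
Qed.

Lemma range_factor k (t : 'I_k -> M) : range t `<=` range b ->
  exists f : {ffun 'I_k -> 'I_m}, t = b \o f.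
Proof.
move=> tb; have tbi i : exists j, b j = t i.
  by have [j _ <-] := tb _ (imageT t i); exists j.
exists [ffun i => sval (cid (tbi i))]; apply/funext => i /=.
by rewrite ffunE; case: cid.
Qed.

(** The copies of [b] range over all of [M] here and depend on [c]; a finite set serving all
    colourings is obtained afterwards by compactness. *)
Lemma amenable_colouring (c : ('I_n -> M) -> {ffun 'I_r -> bool}) :
  amenable R (Aut M) ->
  exists v : formal_comb R ('I_m -> M), convex_comb (copies setT b) v /\
    forall a' a'', copies (range b) a a' -> copies (range b) a a'' ->
      colour c (comb_circ b v a') = colour c (comb_circ b v a'').
Proof.
move=> amG; pose x0 : X := fun q => c q.1 q.2.
have [mu [mu_inv mu_orb]] := amenable_orbit_measure x0
  (@colour_space_hausdorff L M n r) (@colour_space_compact L M n r)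
  (@colour_actP L M n r) amG.
pose lam (p : P) : R := fine (mu (pat @^-1` [set p])).
have mpat (Q : set P) : measurable (pat @^-1` Q : set (borel X)).
  by apply: sub_sigma_algebra; exact: open_pat.
have lamE (Q : pred P) :
    \sum_(p | Q p) lam p = fine (mu (pat @^-1` [set p | Q p])).
  rewrite -big_enum/=.
  rewrite (_ : [set p | Q p] = [set p | p \in enum Q]); last first.
    by apply/seteqP; split=> p /=; rewrite mem_enum.
  by rewrite (probability_preimage_seq mu (fun p => mpat [set p]))// enum_uniq.
(* A pattern of positive weight is an open set meeting the orbit of x0. *)
pose g (p : P) : Aut M := xget 1%g [set g | pat (colour_act g x0) = p].
have gP p : lam p != 0 -> pat (colour_act (g p) x0) = p.
  move=> lp; apply: (@xgetPex (Aut M) 1%g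
    [set g | pat (colour_act g x0) = p]).
  apply: (mu_orb (pat @^-1` [set p])); first exact: open_pat.
  by apply: contraNneq lp; rewrite /lam => ->.
have rP (F : P -> R) : \sum_(i < #|P|) F (enum_val i) = \sum_p F p.
  by rewrite -big_enum_val/=; apply: eq_bigl.
(* Patterns of weight zero are kept as well; a pattern that is not realised gets the default
   [g p = 1]. *)
exists (FormalComb (fun i : 'I_#|P| => lam (enum_val i))
  (fun i => ((g (enum_val i))^-1)%g \o b)); split.
  split => /=.
  - by apply/card_gt0P; exists (pat x0).
  - by move=> i; split => //; eexists.
  - move=> i; rewrite fine_ge0 ?measure_ge0//=.
    rewrite -lee_fin fineK ?probability_le1//.
    exact: fin_num_measure.
  - rewrite (rP lam) (lamE xpredT) (_ : _ @^-1` _ = setT).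
      by rewrite probability_setT.
    by apply/seteqP; split.
(* The mean colour of [a'] equals a quantity in which only [a] occurs, which makes it the same for
   all copies. *)
have colE a' : copies (range b) a a' -> forall j,
    colour c (comb_circ b (FormalComb (fun i : 'I_#|P| => lam (enum_val i))
      (fun i => ((g (enum_val i))^-1)%g \o b)) a') ord0 j =
    fine (mu [set y : X | y (a, j)]).
  move=> [a'b [f fa]] j.
  have [k kE] := range_factor a'b.
  rewrite mxE /=.
  transitivity (\sum_(i < #|P|) lam (enum_val i) * (enum_val i (k, j))%:R).
    apply: eq_bigr => i _; have [->|/gP gi] := eqVneq (lam (enum_val i)) 0.
      by rewrite !mul0r.
    congr (_ * _%:R).
    rewrite (@transporterE _ _ _ _ b _ _ (g (enum_val i))^-1%g a'b erefl).
    by rewrite -{2}gi ffunE /= kE.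
  rewrite (rP (fun p => lam p * (p (k, j))%:R)).
  rewrite (eq_bigr (fun p : P => if p (k, j) then lam p else 0)); last first.
    by move=> p _; case: (p _); rewrite ?mulr1 ?mulr0.
  rewrite -big_mkcond/= (lamE (fun p => p (k, j))); congr fine.
  have yE (y : X) : colour_act (f^-1)%g y (a, j) = y (b \o k, j).
    by rewrite -kE fa -[in RHS](invgK f).
  (* Since [a' = f \o a], acting by the inverse of [f] turns the event at [a] into the event at
     [a']. *)
  rewrite -[RHS](mu_inv (f^-1)%g).
    transitivity (mu [set y : X | y (b \o k, j)]); congr (mu _).
      by apply/seteqP; split=> y; rewrite /= ffunE.
    by apply/funext => y; exact: (esym (congr1 is_true (yE y))).
  apply: sub_sigma_algebra; rewrite openE => y /= ya.
  by apply: filterS (near_colour y (a, j)) => z /= ->.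
move=> a' a'' ca' ca''; apply/rowP => j.
by rewrite (colE _ ca') (colE _ ca'').
Qed.

End strong_ECRP.

(** The combination found for [c] also works, exactly, for every colouring in the set [good c].
    These sets cover the compact space of colourings, so finitely many combinations suffice. *)
Lemma amenable_strong_ECRP (R : realType) (L : language) (M : structure L) :
  amenable R (Aut M) -> strong_ECRP R M.
Proof.
move=> amG n a B m b fB bB; rewrite -{}bB in fB * => ab r.
pose X := @colour_space L M n r.
pose v (c : X) := sval (cid (amenable_colouring a b (colouring_of c) amG)).
have vP (c : X) : convex_comb (copies setT b) (v c) /\
    forall a' a'', copies (range b) a a' -> copies (range b) a a'' ->
      colour (colouring_of c) (comb_circ b (v c) a') =
      colour (colouring_of c) (comb_circ b (v c) a'').
  exact: svalP (cid (amenable_colouring a b (colouring_of c) amG)).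
pose good (c : X) : set X := [set d |
  forall a' a'', copies (range b) a a' -> copies (range b) a a'' ->
    colour (colouring_of d) (comb_circ b (v c) a') =
    colour (colouring_of d) (comb_circ b (v c) a'')].
have good_open c : open (good c).
  rewrite openE => d gd.
  (* Membership in [good c] reads only finitely many bits of a colouring: those at the moved tuples
     of [range b]. *)
  have : \forall d' \near d, forall q : 'I_(comb_size (v c)) *
      {ffun 'I_n -> 'I_m} * 'I_r,
      d' (transporter b (comb_point (v c) q.1.1) \o (b \o q.1.2), q.2) =
      d (transporter b (comb_point (v c) q.1.1) \o (b \o q.1.2), q.2).
    apply: (@filter_forall _ _ (fun q : 'I_(comb_size (v c)) *
        {ffun 'I_n -> 'I_m} * 'I_r => [set d' : X |
      d' (transporter b (comb_point (v c) q.1.1) \o (b \o q.1.2), q.2) =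
      d (transporter b (comb_point (v c) q.1.1) \o (b \o q.1.2), q.2)]) _
      (nbhs_filter d)) => q.
    exact: near_colour.
  apply: filterS => d' d'd.
  have E a' : copies (range b) a a' ->
      colour (colouring_of d') (comb_circ b (v c) a') =
      colour (colouring_of d) (comb_circ b (v c) a') :> 'rV[R]_r.
    move=> [/range_factor[k ->] _]; apply/rowP => j; rewrite !mxE.
    apply: eq_bigr => i _ /=; congr (_ * _%:R).
    by rewrite !ffunE (d'd (i, k, j)).
  by move=> a' a'' ca' ca''; rewrite !E//; exact: gd.
have := @colour_space_compact L M n r; rewrite compact_cover.
move=> /(_ X setT good (fun c _ => good_open c)) [].
  by move=> c _; exists c => //; exact: (vP c).2.
move=> D _ Dcov.
(* The set [C] collects [range b] and all copies of [b] used by the finite subcover. *)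
exists (range b `|` \bigcup_(c in [set` D])
  \bigcup_(i in setT) range (comb_point (v c) i)); split.
- rewrite finite_setU; split => //.
  apply: bigcup_finite => // c _; apply: bigcup_finite => [|i _].
    exact: finite_finset.
  by apply: finite_image; exact: finite_finset.
- exact: subsetUl.
move=> c; pose d : X := fun q => c q.1 q.2.
have dE : colouring_of d = c.
  by apply/funext => t; apply/ffunP => j; rewrite ffunE.
have [e De gd] := Dcov d I.
exists (v e); have [[v0 vC v01 v1] _] := vP e; split.
  split => // i; have [_ vi] := vC i; split => //.
  by move=> x [k _ <-]; right; exists e => //; exists i => //; exists k.
move=> a' a'' ca' ca''; rewrite -dE (gd _ _ ca' ca'').
by rewrite subrr normr0.
Qed.

Theorem theorem5p3 (R : realType) (L : language) (M : structure L) :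
  (amenable R (Aut M) <-> ECRP R M) /\ (ECRP R M <-> strong_ECRP R M).
Proof.
have strongW : strong_ECRP R M -> ECRP R M.
  move=> sE e e0 n a B m b fB bB aB r.
  have [C [fC BC CP]] := sE n a B m b fB bB aB r.
  exists C; split => // c; have [v [vC vP]] := CP c.
  exists v; split => // a' a'' ca' ca''.
  exact: le_trans (vP _ _ ca' ca'') (ltW e0).
have amS := @amenable_strong_ECRP R L M.
have Eam := @ECRP_amenable R L M.
by split; [split=> [/amS/strongW|]|split=> [/Eam/amS|]].
Qed.
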